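(* Let $G$ be a finite simple bipartite graph with (non-empty) partite sets $U$ and $W$, and let $\Delta_U$ denote the maximum degree of a vertex from $U$. Then $$\mathcal M(G)\le\lambda_{\max}(G)\le\sqrt{\big(\log\Delta_U+1\big)\big(\tfrac14\log|W|+1\big)}\,\mathcal M(G).$$
   Context: $\lambda_{\max}(G)$ is the largest eigenvalue of the adjacency matrix $A$ of $G$. For subsets $X,Y$ of the vertex set $V$, $e(X,Y)$ is the number of ordered pairs $(x,y)\in X\times Y$ with $xy$ an edge (equivalently $\xi^tA\eta$ for the characteristic vectors $\xi,\eta$), and $\mathcal M(G):=\max_{\emptyset\ne X,Y\subseteq V}e(X,Y)/\sqrt{|X||Y|}$. $\log$ is the natural logarithm. *)

(* Defs.v *)
(* MathComp / MathComp-Analysis *)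
From mathcomp Require Import all_boot all_order all_algebra lra complex polyrcf.
From mathcomp Require Import classical_sets reals.
(* again, so that set0 is the one of finset and not that of classical_sets *)
From mathcomp Require Import finset.

Set Implicit Arguments.
Unset Strict Implicit.
Unset Printing Implicit Defensive.

Import Order.TTheory GRing.Theory Num.Theory.

Local Open Scope ring_scope.

Definition simple_graph (T : finType) (e : rel T) : Prop :=
  symmetric e /\ irreflexive e.

Definition bipartition (T : finType) (e : rel T) (U W : {set T}) : Prop :=
  [/\ U :|: W = [set: T], [disjoint U & W] &
      forall x y, e x y -> (x \in U) && (y \in W) || (x \in W) && (y \in U)].

Definition degree (T : finType) (e : rel T) (x : T) : nat :=
  #|[set y | e x y]|.

Definition maxdeg_in (T : finType) (e : rel T) (U : {set T}) : nat :=
  \max_(u in U) degree e u.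

Definition adjmx (R : realType) (T : finType) (e : rel T) : 'M[R]_#|T| :=
  \matrix_(i, j) (e (enum_val i) (enum_val j))%:R.

(* The supremum is attained when e is symmetric and T is nonempty:
   see lambda_max_eigenvalue and eigenvalue_le_lambda_max below. *)
Definition lambda_max (R : realType) (T : finType) (e : rel T) : R :=
  sup [set a : R | eigenvalue (adjmx R e) a]%classic.

Definition edge_pairs (T : finType) (e : rel T) (X Y : {set T}) : nat :=
  #|[set p : T * T | [&& p.1 \in X, p.2 \in Y & e p.1 p.2]]|.

(* All the quotients are nonnegative, so the default value 0 does not affect
   the maximum as soon as T is nonempty. *)
Definition calM (R : realType) (T : finType) (e : rel T) : R :=
  \big[Num.max/0]_(p : {set T} * {set T} | (p.1 != set0) && (p.2 != set0))
    ((edge_pairs e p.1 p.2)%:R / Num.sqrt (#|p.1|%:R * #|p.2|%:R)).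

Lemma has_real_eigenvalue (R : realType) (T : finType) (e : rel T)
    (e_sym : symmetric e) (T_gt0 : (0 < #|T|)%N) :
  exists a, eigenvalue (adjmx R e) a.
Proof.
set A := adjmx R e.
pose f := real_complex R.
pose B : 'M[R[i]]_#|T| := map_mx f A.
have [z] : exists z, root (char_poly B) z.
  by apply/closed_rootP; rewrite size_char_poly eqSS -lt0n.
rewrite -eigenvalue_root_char => /eigenvalueP[v vB v0].
have Bconj : (map_mx Num.conj B)^T = B.
  apply/matrixP => i j; rewrite !mxE e_sym.
  by case: (e _ _); rewrite /f ?rmorph1 ?rmorph0 ?conjC1 ?conjC0.
pose vs : 'cV_#|T| := (map_mx Num.conj v)^T.
have Bvs : B *m vs = z^* *: vs.
  by rewrite -{1}Bconj /vs -trmx_mul -map_mxM vB map_mxZ linearZ.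
have vvs : (v *m vs) 0 0 != 0.
  have [j vj] : exists j, v 0 j != 0.
    by case/rV0Pn: v0 => j; exists j.
  rewrite mxE psumr_neq0.
    apply/hasP; exists j; rewrite ?mem_index_enum //=.
    by rewrite !mxE -normCK exprn_gt0 // normr_gt0.
  by move=> k _; rewrite !mxE mul_conjC_ge0.
have zreal : z = z^*.
  have /matrixP/(_ 0 0) : z *: (v *m vs) = z^* *: (v *m vs).
    by rewrite scalemxAl -vB -mulmxA Bvs -scalemxAr.
  by rewrite !mxE -!/(_ *m _) => /(mulIf _); apply; move: vvs; rewrite mxE.
case: z zreal vB {Bvs} => a b zreal vB.
have bN : b = - b by case: zreal.
have b0 : b = 0 by lra.
exists a; rewrite eigenvalue_root_char -(fmorph_root f) map_char_poly.
rewrite -eigenvalue_root_char; apply/eigenvalueP; exists v => //.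
by rewrite vB b0.
Qed.

Lemma has_max_eigenvalue (R : realType) (T : finType) (e : rel T)
    (e_sym : symmetric e) (T_gt0 : (0 < #|T|)%N) :
  exists2 m, eigenvalue (adjmx R e) m &
    forall a, eigenvalue (adjmx R e) a -> a <= m.
Proof.
set A := adjmx R e.
have [a aE] := has_real_eigenvalue R e_sym T_gt0.
pose s := rootsR (char_poly A).
have sE x : eigenvalue A x = (x \in s).
  rewrite -roots_on_rootsR ?monic_neq0 ?char_poly_monic //.
  by rewrite eigenvalue_root_char in_itv.
rewrite sE in aE.
have [m ms mmax] : exists2 m, m \in s & forall x, x \in s -> x <= m.
  elim: (s) a aE => // c t IHt a _.
  have [->|[d dt]] : t = [::] \/ exists d, d \in t.
    by case: (t) => [|d t']; [left|right; exists d; rewrite mem_head].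
    by exists c; rewrite ?mem_head // => x; rewrite inE => /eqP->.
  have [m mt mmax] := IHt d dt.
  have [cm|/ltW mc] := leP c m.
    exists m => [|x]; first by rewrite inE mt orbT.
    by rewrite inE => /orP[/eqP->|/mmax].
  exists c => [|x]; first exact: mem_head.
  by rewrite inE => /orP[/eqP->//|/mmax /le_trans]; apply.
by exists m => [|x]; rewrite sE //; exact: mmax.
Qed.

Lemma eigenvalue_le_lambda_max (R : realType) (T : finType) (e : rel T)
    (e_sym : symmetric e) (T_gt0 : (0 < #|T|)%N) a :
  eigenvalue (adjmx R e) a -> a <= lambda_max R e.
Proof.
have [m mE mmax] := has_max_eigenvalue R e_sym T_gt0 => aE.
by apply: ub_le_sup => //; exists m => x /mmax.
Qed.

Lemma lambda_max_eigenvalue (R : realType) (T : finType) (e : rel T)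
    (e_sym : symmetric e) (T_gt0 : (0 < #|T|)%N) :
  eigenvalue (adjmx R e) (lambda_max R e).
Proof.
have [m mE mmax] := has_max_eigenvalue R e_sym T_gt0.
suff -> : lambda_max R e = m by [].
apply/eqP; rewrite eq_le eigenvalue_le_lambda_max // andbT.
by apply: ge_sup => [|x /mmax //]; exists m.
Qed.

(* Main.v *)
Require Import Defs.
From mathcomp Require Import all_boot all_order all_algebra ring lra.
From mathcomp Require Import complex spectral sesquilinear.
From mathcomp Require Import classical_sets topology normedtype derive.
From mathcomp Require Import fintype finset reals exp.

(* Lower bound: by the spectral theorem and the symmetry of the spectrum of a
   bipartite graph, |2 <f, A g>| <= lambda_max (|f|^2 + |g|^2); take normalised
   indicator functions.

   Upper bound: with M = calM, the vertices having at least k neighbours in a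
   set Y of vertices of W send at most M^2 |Y| / k edges to Y, so that
   |A 1_Y|^2 <= (ln Delta_U + 1) M^2 |Y|. For a nonnegative function y on W with
   values y_1 >= y_2 >= ..., decomposing y into indicator functions of its level
   sets gives |A y| <= sqrt (ln Delta_U + 1) M \sum_k (sqrt k - sqrt (k - 1)) y_k,
   and by Cauchy-Schwarz the sum is at most sqrt (ln |W| / 4 + 1) |y|. Apply this
   to the absolute values on W of an eigenvector for lambda_max. *)

Set Implicit Arguments.
Unset Strict Implicit.
Unset Printing Implicit Defensive.

Import Order.TTheory GRing.Theory Num.Theory.
Import numFieldNormedType.Exports.

Local Open Scope ring_scope.

(** * Logarithmic bounds for the two numerical sums *)

Lemma ln_ge_1BV (R : realType) (x : R) : 0 < x -> 1 - x^-1 <= ln x.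
Proof.
move=> x0; have := @le_ln1Dx R (x^-1 - 1).
rewrite ltrBrDl subrr invr_gt0 => /(_ x0).
by rewrite addrC subrK lnV // => ?; lra.
Qed.

(** The difference of the two sides vanishes at 1 and has derivative [ln x + x^-1 - 1], nonnegative
    by [ln_ge_1BV]. *)
Lemma ln_ge_pade (R : realType) (r : R) : 1 <= r -> 2 * (r - 1) <= (r + 1) * ln r.
Proof.
rewrite le_eqVlt => /predU1P[<-|r1]; first by rewrite ln1 subrr !mulr0.
pose f (x : R) := (x + 1) * ln x - 2 * (x - 1).
have f' (x : R) : 0 < x -> is_derive x 1 f (ln x + x^-1 - 1).
  move=> x0; apply: is_derive_eq.
    by apply: is_deriveB; first (apply: is_deriveM; exact: is_derive1_ln).
  rewrite /GRing.scale /=; field; lra.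
have [c] : exists2 c, c \in `]1, r[%R & f r - f 1 = (ln c + c^-1 - 1) * (r - 1).
  apply: MVT => // [x|]; first by rewrite in_itv /= => /andP[x1 _]; apply: f'; lra.
  apply: derivable_within_continuous => x; rewrite in_itv /= => /andP[x1 _].
  by have [] := f' x ltac:(lra).
rewrite in_itv /= => /andP[c1 _]; rewrite /f ln1 subrr !mulr0 subr0 => e.
have := @ln_ge_1BV R c ltac:(lra) => h.
have : 0 <= (ln c + c^-1 - 1) * (r - 1) by apply: mulr_ge0; lra.
by rewrite -e; lra.
Qed.

(** With [a], [b] the roots of [x + 1] and [x], [ln_ge_pade] at [a / b] gives
    [2 * (a - b) <= (a + b) * (ln a - ln b)]. Multiply by [a - b] and use [(a - b) * (a + b) = 1];
    the 1/4 combines this 2 with [ln a = ln (x + 1) / 2]. *)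
Lemma sqrt_incr_sqr_le (R : realType) (x : R) : 0 < x ->
  (Num.sqrt (x + 1) - Num.sqrt x) ^+ 2 <= 4^-1 * (ln (x + 1) - ln x).
Proof.
move=> x0; set a := Num.sqrt (x + 1); set b := Num.sqrt x.
have a2 : a ^+ 2 = x + 1 by rewrite sqr_sqrtr //; lra.
have b2 : b ^+ 2 = x by rewrite sqr_sqrtr //; lra.
have a0 : 0 < a by rewrite sqrtr_gt0; lra.
have b0 : 0 < b by rewrite sqrtr_gt0.
have ab : b <= a by rewrite ler_wsqrtr //; lra.
have := @ln_ge_pade R (a / b); rewrite ler_pdivlMr // mul1r => /(_ ab).
rewrite -a2 -[in ln x]b2 !lnXn // ln_div // => h.
set l := ln a - ln b in h.
have -> : ln a *+ 2 - ln b *+ 2 = 2 * l by rewrite /l; ring.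
have h1 : 2 * (a - b) <= (a + b) * l.
  have := ler_wpM2r (ltW b0) h.
  have -> : 2 * (a / b - 1) * b = 2 * (a - b) by field; lra.
  by have -> : (a / b + 1) * l * b = (a + b) * l by field; lra.
have e1 : (a - b) * (a + b) = 1 by rewrite -subr_sqr a2 b2; ring.
have : 0 <= (a - b) * ((a + b) * l - 2 * (a - b)) by apply: mulr_ge0; lra.
by rewrite mulrBr mulrA e1; lra.
Qed.

Lemma sum_sqrt_incr_sqr_le (R : realType) n :
  \sum_(k < n.+1) (Num.sqrt k.+1%:R - Num.sqrt k%:R) ^+ 2
    <= 4^-1 * ln n.+1%:R + 1 :> R.
Proof.
elim: n => [|n IHn]; first by rewrite big_ord1 sqrtr0 sqrtr1 ln1; lra.
rewrite big_ord_recr /=; have := @sqrt_incr_sqr_le R n.+1%:R ltac:(by rewrite ltr0n).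
by rewrite natr1; move: IHn; lra.
Qed.

Lemma harmonic_le_ln (R : realType) n :
  \sum_(k < n) k.+1%:R^-1 <= ln n%:R + 1 :> R.
Proof.
(* [ln] takes the value 0 at 0, so the bound also covers an edgeless graph. *)
elim: n => [|[|n] IHn]; first by rewrite big_ord0 ln0 ?add0r.
  by rewrite big_ord1 ln1 invr1 add0r.
rewrite big_ord_recr /=.
suff h : n.+2%:R^-1 <= ln n.+2%:R - ln n.+1%:R :> R.
  by apply: le_trans (lerD IHn h) _; rewrite addrAC addrCA subrr addr0.
rewrite -ln_div ?posrE ?ltr0n //.
(* At [x = (n + 2) / (n + 1)] the lower bound [1 - x^-1] is exactly [1 / (n + 2)]. *)
apply: le_trans (ln_ge_1BV _); last by rewrite divr_gt0 ?ltr0n.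
rewrite invf_div -natr1 le_eqVlt; apply/orP; left; apply/eqP.
have h := ltr0Sn R n; field; lra.
Qed.

(** * Eigenvectors and quadratic forms of the adjacency matrix *)

Lemma eigenvalue_adjmxP (R : realType) (T : finType) (e : rel T) (a : R) :
  eigenvalue (adjmx R e) a ->
  exists2 f : T -> R, exists x, f x != 0 &
    forall y, \sum_x f x * (e x y)%:R = a * f y.
Proof.
case/eigenvalueP => v vA /rV0Pn[j vj].
exists (fun x => v 0 (enum_rank x)); first by exists (enum_val j); rewrite enum_valK.
move=> y; have /rowP/(_ (enum_rank y)) := vA.
rewrite !mxE => <-; rewrite (reindex (@enum_val T T)) /=; last first.
  by apply: onW_bij; exact: enum_val_bij.
by apply: eq_bigr => i _; rewrite enum_valK !mxE enum_rankK.
Qed.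

Local Open Scope sesquilinear_scope.

(** The complexified matrix is Hermitian, hence unitarily diagonalisable with real eigenvalues; in
    the new coordinates the two forms compare term by term. *)
Lemma quadratic_form_le_lambda_max_mx (R : realType) (T : finType) (e : rel T)
    (e_sym : symmetric e) (T_gt0 : (0 < #|T|)%N) (x : 'rV[R]_#|T|) :
  (x *m adjmx R e *m x^T) 0 0 <= lambda_max R e * (x *m x^T) 0 0.
Proof.
set A := adjmx R e; pose f := real_complex R.
pose B : 'M[R[i]]_#|T| := map_mx f A.
have fC (z : R) : (f z)^* = f z by exact: conjc_real.
have Bherm : B \is hermsymmx.
  apply: realsym_hermsym.
    apply/is_hermitianmxP; rewrite expr0 scale1r; apply/matrixP => i j.
    by rewrite !mxE e_sym.
  by apply/mxOverP => i j; rewrite mxE; apply/CrealP; exact: fC.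
have /orthomx_spectralP := hermitian_normalmx Bherm.
have := spectral_unitarymx B.
have := hermitian_spectral_diag_real Bherm.
set P := spectralmx B; set d := spectral_diag B => dreal Pu BE.
(* Row [i] of [P] is an eigenvector for [d 0 i], nonzero by unitarity. Being real, [d 0 i] is also a
   root of the real characteristic polynomial. *)
have d_le i : d 0 i <= f (lambda_max R e).
  have : eigenvalue B (d 0 i).
    apply/eigenvalueP; exists (row i P); last first.
      apply/negP => /eqP Pi0; have /row_unitarymxP/(_ i i) := Pu.
      by rewrite Pi0 eqxx => /eqP; rewrite linear0l eq_sym oner_eq0.
    rewrite -row_mul {1}BE !mulmxA mulmxV ?unitarymx_unit // mul1mx.
    by rewrite row_mul row_diag_mx -scalemxAl -rowE.
  have /CrealP := mxOverP dreal 0 i.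
  case: (d 0 i) => a b [] bN.
  have -> : b = 0 by lra.
  rewrite -[(a +i* 0)%C]/(f a) eigenvalue_root_char -map_char_poly fmorph_root.
  rewrite -eigenvalue_root_char => /(eigenvalue_le_lambda_max e_sym T_gt0).
  by rewrite lecR.
pose xC := map_mx f x; pose p := xC *m P^t*.
have xCt : xC^T = xC^t*.
  by apply/matrixP => i j; rewrite !mxE fC.
have pE : P *m xC^T = p^t*.
  by rewrite {1}xCt /p trmx_mul map_mxM trmxCK.
rewrite -(@lecR R) rmorphM /=.
have -> : ((x *m A *m x^T) 0 0)%:C%C = (p *m diag_mx d *m p^t*) 0 0.
  rewrite -pE /p -!mulmxA (mulmxA (diag_mx d)) (mulmxA (P^t*)) -invmx_unitary //.
  rewrite (mulmxA (invmx P)) -BE mulmxA [in RHS]map_trmx -!map_mxM [in RHS]mxE.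
  by rewrite mulmxA.
rewrite [X in _ * X](_ : _ = (p *m p^t*) 0 0); last first.
  rewrite -pE /p -!mulmxA (mulmxA (P^t*)) -invmx_unitary // mulVmx ?unitarymx_unit //.
  by rewrite mul1mx [in RHS]map_trmx -!map_mxM [in RHS]mxE.
rewrite !mxE mulr_sumr; apply: ler_sum => i _.
rewrite mul_mx_diag !mxE mulrAC mulrC.
by apply: ler_wpM2r; [exact: mul_conjC_ge0 | exact: d_le].
Qed.
Local Close Scope sesquilinear_scope.

Lemma quadratic_form_le_lambda_max (R : realType) (T : finType) (e : rel T)
    (e_sym : symmetric e) (T_gt0 : (0 < #|T|)%N) (f : T -> R) :
  \sum_x \sum_y f x * (e x y)%:R * f y <= lambda_max R e * \sum_x f x ^+ 2.
Proof.
have enum_bij : bijective (@enum_val T T).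
  by exists enum_rank; [exact: enum_valK|exact: enum_rankK].
pose v : 'rV[R]_#|T| := \row_i f (enum_val i).
have := quadratic_form_le_lambda_max_mx e_sym T_gt0 v.
rewrite !mxE; set lhs := (X in X <= _); set rhs := (X in _ * X).
have -> : lhs = \sum_x \sum_y f x * (e x y)%:R * f y.
  rewrite /lhs exchange_big /= (reindex (@enum_val T T)) /=; last exact: onW_bij.
  apply: eq_bigr => j _; rewrite !mxE mulr_suml.
  rewrite (reindex (@enum_val T T)) /=; last exact: onW_bij.
  by apply: eq_bigr => i _; rewrite !mxE.
suff -> : rhs = \sum_x f x ^+ 2 by [].
rewrite /rhs (reindex (@enum_val T T)) /=; last exact: onW_bij.
by apply: eq_bigr => i _; rewrite !mxE expr2.
Qed.

(* Changing the sign of f on W changes the sign of its quadratic form. *)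
Lemma quadratic_form_ge_lambda_max (R : realType) (T : finType) (e : rel T)
    (U W : {set T}) (e_sym : symmetric e) (UW_bip : bipartition e U W)
    (T_gt0 : (0 < #|T|)%N) (f : T -> R) :
  - (\sum_x \sum_y f x * (e x y)%:R * f y) <= lambda_max R e * \sum_x f x ^+ 2.
Proof.
have [_ UW_dis bip] := UW_bip.
pose s x : R := (-1) ^+ (x \in W).
have := quadratic_form_le_lambda_max e_sym T_gt0 (fun x => s x * f x).
under [X in _ <= _ * X]eq_bigr do rewrite exprMn sqrr_sign mul1r.
congr (_ <= _); rewrite -sumrN; apply: eq_bigr => x _.
rewrite -sumrN; apply: eq_bigr => y _; rewrite /s.
case exy: (e x y); last by rewrite !(mulr0, mul0r) oppr0.
case/orP: (bip _ _ exy) => /andP[xU yU].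
  by rewrite yU (disjointFr UW_dis xU) expr0 expr1; ring.
by rewrite xU (disjointFr UW_dis yU) expr0 expr1; ring.
Qed.

(** Polarisation: add the upper bound at [f + g] to the lower bound at [f - g]. *)
Lemma bilinear_form_le_lambda_max (R : realType) (T : finType) (e : rel T)
    (U W : {set T}) (e_sym : symmetric e) (UW_bip : bipartition e U W)
    (T_gt0 : (0 < #|T|)%N) (f g : T -> R) :
  2 * (\sum_x \sum_y f x * (e x y)%:R * g y)
    <= lambda_max R e * (\sum_x f x ^+ 2 + \sum_x g x ^+ 2).
Proof.
have hD := quadratic_form_le_lambda_max e_sym T_gt0 (fun x => f x + g x).
have hB := quadratic_form_ge_lambda_max e_sym UW_bip T_gt0 (fun x => f x - g x).
pose q (h k : T -> R) := \sum_x \sum_y h x * (e x y)%:R * k y.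
have qC : q g f = q f g.
  rewrite /q exchange_big /=; apply: eq_bigr => x _; apply: eq_bigr => y _.
  by rewrite e_sym; ring.
have qD : \sum_x \sum_y (f x + g x) * (e x y)%:R * (f y + g y)
    = q f f + q f g + q g f + q g g.
  rewrite /q -!big_split; apply: eq_bigr => x _; rewrite -!big_split.
  by apply: eq_bigr => y _ /=; ring.
have qB : \sum_x \sum_y (f x - g x) * (e x y)%:R * (f y - g y)
    = q f f - q f g - q g f + q g g.
  rewrite /q -!sumrN -!big_split; apply: eq_bigr => x _ /=.
  by rewrite -!sumrN -!big_split; apply: eq_bigr => y _ /=; ring.
have nE : \sum_x (f x + g x) ^+ 2 + \sum_x (f x - g x) ^+ 2
    = 2 * (\sum_x f x ^+ 2 + \sum_x g x ^+ 2).
  rewrite -!big_split mulr_sumr; apply: eq_bigr => x _ /=; ring.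
have := lerD hD hB; rewrite -mulrDr nE qD qB qC -/(q f g) mulrCA; lra.
Qed.

(** * Edge counts and the lower bound *)

Lemma edge_pairsE (R : realType) (T : finType) (e : rel T) (X Y : {set T}) :
  (edge_pairs e X Y)%:R = \sum_(x in X) \sum_(y in Y) (e x y)%:R :> R.
Proof.
rewrite /edge_pairs -sum1_card natr_sum pair_big_dep /=.
rewrite [RHS]big_mkcond [LHS]big_mkcond /=; apply: eq_bigr => -[x y] _.
by rewrite inE /=; case: (x \in X); case: (y \in Y); case: (e x y).
Qed.

Lemma sum_indicator_sqr (R : realType) (T : finType) (X : {set T}) (c : R) :
  \sum_x (c * (x \in X)%:R) ^+ 2 = c ^+ 2 * #|X|%:R.
Proof.
rewrite -sum1_card natr_sum mulr_sumr [RHS]big_mkcond; apply: eq_bigr => x _.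
by case: (x \in X); rewrite ?mulr1 ?mulr0 ?expr0n.
Qed.

Lemma edge_pairs_le_lambda_max (R : realType) (T : finType) (e : rel T)
    (U W : {set T}) (e_sym : symmetric e) (UW_bip : bipartition e U W)
    (X Y : {set T}) : X != set0 -> Y != set0 ->
  (edge_pairs e X Y)%:R / Num.sqrt (#|X|%:R * #|Y|%:R) <= lambda_max R e.
Proof.
rewrite -!card_gt0 => X0 Y0.
have T_gt0 : (0 < #|T|)%N by apply: leq_trans X0 (max_card _).
have [x0 y0] : 0 < Num.sqrt #|X|%:R :> R /\ 0 < Num.sqrt #|Y|%:R :> R.
  by rewrite !sqrtr_gt0 !ltr0n.
pose f x : R := (Num.sqrt #|X|%:R)^-1 * (x \in X)%:R.
pose g x : R := (Num.sqrt #|Y|%:R)^-1 * (x \in Y)%:R.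
have := bilinear_form_le_lambda_max e_sym UW_bip T_gt0 f g.
rewrite !sum_indicator_sqr !exprVn !sqr_sqrtr ?ler0n // !mulVf ?pnatr_eq0 -?lt0n //.
suff -> : \sum_x \sum_y f x * (e x y)%:R * g y
    = (edge_pairs e X Y)%:R / Num.sqrt (#|X|%:R * #|Y|%:R) by move=> ?; lra.
rewrite edge_pairsE sqrtrM ?ler0n // mulr_suml [RHS]big_mkcond.
apply: eq_bigr => x _; rewrite /f; case: (x \in X); last first.
  by rewrite big1 // => y _; rewrite mulr0 !mul0r.
rewrite mulr_suml [RHS]big_mkcond; apply: eq_bigr => y _; rewrite /g.
by case: (y \in Y); rewrite ?mulr0 // !mulr1 invfM; ring.
Qed.

Lemma calM_le_lambda_max (R : realType) (T : finType) (e : rel T)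
    (U W : {set T}) (e_sym : symmetric e) (UW_bip : bipartition e U W) :
  U != set0 -> calM R e <= lambda_max R e.
Proof.
move=> U_neq0; apply: bigmax_le => [|[X Y] /andP[/= X0 Y0]]; last first.
  exact: edge_pairs_le_lambda_max UW_bip _ _ X0 Y0.
(* The default value 0 of the maximum requires [0 <= lambda_max R e]; the quotient at [X = Y = U]
   provides it. *)
by apply: le_trans (edge_pairs_le_lambda_max R e_sym UW_bip U_neq0 U_neq0);
  rewrite divr_ge0 ?sqrtr_ge0.
Qed.

(** * Cauchy-Schwarz and Abel summation *)

Lemma cauchy_schwarz_sum (R : realType) (T : finType) (P : pred T) (f g : T -> R) :
  (\sum_(x | P x) f x * g x) ^+ 2
    <= (\sum_(x | P x) f x ^+ 2) * (\sum_(x | P x) g x ^+ 2).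
Proof.
(* Lagrange's identity: this double sum is twice the difference of the two sides. *)
have h : 0 <= \sum_(x | P x) \sum_(y | P y) (f x * g y - f y * g x) ^+ 2.
  by apply: sumr_ge0 => x _; apply: sumr_ge0 => y _; exact: sqr_ge0.
have e1 : \sum_(x | P x) \sum_(y | P y) f x ^+ 2 * g y ^+ 2
   = (\sum_(x | P x) f x ^+ 2) * (\sum_(x | P x) g x ^+ 2).
  by rewrite mulr_suml; apply: eq_bigr => x _; rewrite mulr_sumr.
have e2 : \sum_(x | P x) \sum_(y | P y) f y ^+ 2 * g x ^+ 2
   = (\sum_(x | P x) f x ^+ 2) * (\sum_(x | P x) g x ^+ 2).
  by rewrite exchange_big.
have e3 : \sum_(x | P x) \sum_(y | P y) (f x * g x) * (f y * g y)
   = (\sum_(x | P x) f x * g x) ^+ 2.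
  by rewrite expr2 mulr_suml; apply: eq_bigr => x _; rewrite mulr_sumr.
suff e4 : \sum_(x | P x) \sum_(y | P y) (f x * g y - f y * g x) ^+ 2 =
   (\sum_(x | P x) \sum_(y | P y) f x ^+ 2 * g y ^+ 2
   + \sum_(x | P x) \sum_(y | P y) f y ^+ 2 * g x ^+ 2)
   - 2 * \sum_(x | P x) \sum_(y | P y) (f x * g x) * (f y * g y).
  by move: h; rewrite e4 e1 e2 e3; lra.
rewrite mulr_sumr -sumrN -!big_split; apply: eq_bigr => x _ /=.
rewrite mulr_sumr -sumrN -!big_split; apply: eq_bigr => y _ /=; ring.
Qed.

(* The weights c are the increments of the square root along an enumeration of
   W by decreasing y; the estimate is Abel summation, done by splitting off the
   minimum of y on W. *)
Lemma sum_le_sqrt_weights (R : realType) (T : finType) (W : {set T})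
    (g y : T -> R) (K : R) :
  (forall w, w \in W -> 0 <= y w) ->
  (forall Y : {set T}, Y \subset W -> \sum_(w in Y) g w <= K * Num.sqrt #|Y|%:R) ->
  exists c : T -> R,
    [/\ \sum_(w in W) c w ^+ 2
          = \sum_(k < #|W|) (Num.sqrt k.+1%:R - Num.sqrt k%:R) ^+ 2,
        \sum_(w in W) c w = Num.sqrt #|W|%:R &
        \sum_(w in W) g w * y w <= K * \sum_(w in W) c w * y w].
Proof.
move En : #|W| => n; elim: n W En y => [|n IHn] W Wn y y_ge0 gK.
  exists (fun=> 0); have -> : W = set0 by apply: cards0_eq.
  by rewrite big_ord0 !big_set0 sqrtr0 mulr0.
have [w1 w1W] : exists w, w \in W by apply/card_gt0P; rewrite Wn.
have [w0 w0W w0_min] : exists2 w0, w0 \in W & forall w, w \in W -> y w0 <= y w.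
  by case: (arg_minP y w1W) => w0 w0W w0_min; exists w0.
have W'n : #|W :\ w0| = n by move: Wn; rewrite (cardsD1 w0) w0W => -[].
have W'S : W :\ w0 \subset W by apply: subsetDl.
have [||c [c2 c1 cy]] := IHn (W :\ w0) W'n (fun w => y w - y w0).
- by move=> w /(subsetP W'S) /w0_min; rewrite subr_ge0.
- by move=> Y /subset_trans /(_ W'S); exact: gK.
(* The minimiser [w0] comes last in the decreasing enumeration, so it receives the last
   increment. *)
pose d := Num.sqrt n.+1%:R - Num.sqrt n%:R : R.
pose c' w := if w == w0 then d else c w.
have c'0 : c' w0 = d by rewrite /c' eqxx.
have c'E w : w \in W :\ w0 -> c' w = c w.
  by rewrite !inE /c' => /andP[/negPf->].
have split_w0 (F : T -> R) : \sum_(w in W) F w = F w0 + \sum_(w in W :\ w0) F w.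
  by rewrite (big_setD1 w0).
have c'1 : \sum_(w in W) c' w = Num.sqrt n.+1%:R.
  by rewrite split_w0 c'0 (eq_bigr _ c'E) c1 subrK.
exists c'; split => //.
  rewrite split_w0 c'0 big_ord_recr /= addrC; congr (_ + _).
  by rewrite -c2; apply: eq_bigr => w /c'E->.
have shift (F : T -> R) : \sum_(w in W) F w * y w
    = \sum_(w in W :\ w0) F w * (y w - y w0) + y w0 * \sum_(w in W) F w.
  rewrite mulr_sumr split_w0 [\sum_(w in W) y w0 * _]split_w0 addrCA -big_split /=.
  by congr (_ + _); [ring | apply: eq_bigr => w _; ring].
(* The constant layer of height [y w0] is controlled by the hypothesis at [Y = W], whose bound
   matches the total weight. *)
rewrite !shift c'1 mulrDr; apply: lerD.
  by under [X in _ <= _ * X]eq_bigr => w /c'E-> do [].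
by rewrite mulrCA; apply: ler_wpM2l; rewrite ?y_ge0 // -Wn; apply: gK.
Qed.

(** * Degrees into a subset of [W] *)

Lemma calM_ge0 (R : realType) (T : finType) (e : rel T) : 0 <= calM R e.
Proof. exact: bigmax_ge_id. Qed.

(** This division-free form of the bound defining [calM] includes empty sets, where both sides
    vanish. *)
Lemma edge_pairs_sqr_le (R : realType) (T : finType) (e : rel T) (X Y : {set T}) :
  (edge_pairs e X Y)%:R ^+ 2 <= calM R e ^+ 2 * (#|X|%:R * #|Y|%:R).
Proof.
have [X0|X0] := eqVneq X set0.
  rewrite X0 cards0 mul0r mulr0 /edge_pairs (_ : [set _ | _] = set0) ?cards0 ?expr0n //.
  by apply/setP => p; rewrite !inE.
have [Y0|Y0] := eqVneq Y set0.
  rewrite Y0 cards0 !mulr0 /edge_pairs (_ : [set _ | _] = set0) ?cards0 ?expr0n //.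
  by apply/setP => p; rewrite !inE andbF.
have s0 : 0 < Num.sqrt (#|X|%:R * #|Y|%:R) :> R.
  by rewrite sqrtr_gt0 mulr_gt0 // ltr0n card_gt0.
have := @le_bigmax_cond _ _ _ 0 (X, Y) (fun p => (p.1 != set0) && (p.2 != set0))
  (fun p => (edge_pairs e p.1 p.2)%:R / Num.sqrt (#|p.1|%:R * #|p.2|%:R) : R).
rewrite /= X0 Y0 => /(_ isT); rewrite -/(calM R e) ler_pdivrMr // => h.
rewrite -[X in _ <= _ * X]sqr_sqrtr ?mulr_ge0 // -exprMn.
by rewrite lerXn2r ?nnegrE ?ler0n ?mulr_ge0 ?calM_ge0 ?sqrtr_ge0.
Qed.

Definition degree_in (T : finType) (e : rel T) (Y : {set T}) (x : T) : nat :=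
  #|[set y in Y | e x y]|.

Lemma degree_inE (R : realType) (T : finType) (e : rel T) (Y : {set T}) (x : T) :
  (degree_in e Y x)%:R = \sum_(y in Y) (e x y)%:R :> R.
Proof.
rewrite /degree_in -sum1_card natr_sum [LHS]big_mkcond [RHS]big_mkcond /=.
by apply: eq_bigr => y _; rewrite inE; case: (y \in Y); case: (e x y).
Qed.

(* Writing S k for the number of edges between Y and the set of vertices with
   at least k neighbours in Y, the left-hand side is the sum of the S k over
   k >= 1, and S k <= M^2 #|Y| / k since that set has at most S k / k elements. *)
Lemma sum_degree_in_sqr_le (R : realType) (T : finType) (e : rel T)
    (Y : {set T}) (D : nat) : (forall x, (degree_in e Y x <= D)%N) ->
  \sum_x (degree_in e Y x)%:R ^+ 2
    <= calM R e ^+ 2 * #|Y|%:R * \sum_(k < D) k.+1%:R^-1.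
Proof.
move=> degD; pose S k : R := \sum_(x | (k < degree_in e Y x)%N) (degree_in e Y x)%:R.
(* A vertex of degree [d] into [Y] contributes [d] to each of the [d] layers [k < d]. Layer [k]
   requires at least [k.+1] neighbours, whence the denominators. *)
have -> : \sum_x (degree_in e Y x)%:R ^+ 2 = \sum_(k < D) S k.
  rewrite /S (exchange_big_dep xpredT) //=; apply: eq_bigr => x _.
  rewrite -(big_ord_widen _ (fun=> (degree_in e Y x)%:R) (degD x)).
  by rewrite sumr_const card_ord expr2 mulr_natr.
rewrite mulr_sumr; apply: ler_sum => k _.
rewrite ler_pdivlMr ?ltr0n //.
pose X := [set x | (k < degree_in e Y x)%N].
have SE : S k = (edge_pairs e X Y)%:R.
  rewrite edge_pairsE; apply: eq_big => [x|x _]; first by rewrite inE.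
  exact: degree_inE.
have XS : #|X|%:R * k.+1%:R <= S k.
  rewrite -sum1_card natr_sum mulr_suml /S; under [X in X <= _]eq_bigl do rewrite inE.
  by apply: ler_sum => x kx; rewrite mul1r ler_nat.
have := edge_pairs_sqr_le R e X Y; rewrite -SE => S2.
have := ler0n R (edge_pairs e X Y); rewrite -SE le_eqVlt.
case/predU1P => [<-|S0]; first by rewrite mul0r mulr_ge0 ?sqr_ge0.
(* One factor [S k] is cancelled: [S2] bounds its square by a multiple of [#|X|], and [XS] turns
   [#|X|] back into [S k]. *)
rewrite -(ler_pM2l S0) mulrA -expr2.
apply: le_trans (ler_wpM2r (ler0n _ _) S2) _.
have := ler_wpM2l (mulr_ge0 (sqr_ge0 (calM R e)) (ler0n R #|Y|)) XS.
by congr (_ <= _); ring.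
Qed.

(** Vertices outside [U] have no neighbour in [Y], so only degrees in [U] count. *)
Lemma degree_in_le_maxdeg (T : finType) (e : rel T) (U W Y : {set T}) (x : T) :
  bipartition e U W -> Y \subset W -> (degree_in e Y x <= maxdeg_in e U)%N.
Proof.
case=> _ UW_dis bip /subsetP YW; have [xU|xU] := boolP (x \in U).
  apply: (@leq_trans (degree e x)); last exact: (@leq_bigmax_cond _ _ (degree e)).
  by apply: subset_leq_card; apply/subsetP => y; rewrite !inE => /andP[].
rewrite /degree_in (_ : [set _ in _ | _] = set0) ?cards0 //.
apply/setP => y; rewrite !inE; apply/andP => -[/YW yW /bip].
by rewrite (negPf xU) (disjointFl UW_dis yW) andbF.
Qed.

(** * The upper bound *)

(** The level-set argument is linearised by duality: the squared norm [Z] of [z = A y] is the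
    pairing of [y] with [g = A z], and [sum_le_sqrt_weights] applies to this [g]. *)
Lemma sum_neighbours_sqr_le (R : realType) (T : finType) (e : rel T)
    (U W : {set T}) (UW_bip : bipartition e U W) (y : T -> R) :
  (forall w, w \in W -> 0 <= y w) ->
  \sum_x (\sum_(w in W) (e x w)%:R * y w) ^+ 2
    <= calM R e ^+ 2 * (\sum_(k < maxdeg_in e U) k.+1%:R^-1)
       * (\sum_(k < #|W|) (Num.sqrt k.+1%:R - Num.sqrt k%:R) ^+ 2)
       * \sum_(w in W) y w ^+ 2.
Proof.
move=> y_ge0; set H := \sum_(k < maxdeg_in e U) _.
set h := (X in _ * X * _).
pose z x := \sum_(w in W) (e x w)%:R * y w.
set Z := \sum_x _.
have H0 : 0 <= H by apply: sumr_ge0 => k _; rewrite invr_ge0.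
have h0 : 0 <= h by apply: sumr_ge0 => k _; exact: sqr_ge0.
have Y0 : 0 <= \sum_(w in W) y w ^+ 2 by apply: sumr_ge0 => w _; exact: sqr_ge0.
have Z0 : 0 <= Z by apply: sumr_ge0 => x _; exact: sqr_ge0.
pose g w := \sum_x z x * (e x w)%:R.
pose K := Num.sqrt (Z * (calM R e ^+ 2 * H)).
have gK (Y : {set T}) : Y \subset W -> \sum_(w in Y) g w <= K * Num.sqrt #|Y|%:R.
  move=> YW; rewrite -sqrtrM; last by rewrite !mulr_ge0 ?calM_ge0 ?sqr_ge0.
  have -> : \sum_(w in Y) g w = \sum_x z x * (degree_in e Y x)%:R.
    rewrite exchange_big; apply: eq_bigr => x _.
    by rewrite degree_inE mulr_sumr.
  apply: le_trans (ler_norm _) _; rewrite -sqrtr_sqr ler_wsqrtr //.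
  apply: le_trans (cauchy_schwarz_sum _ _ _) _; rewrite -/Z -mulrA ler_wpM2l //.
  rewrite mulrAC; apply: sum_degree_in_sqr_le => x.
  exact: degree_in_le_maxdeg UW_bip YW.
have [c [+ _]] := sum_le_sqrt_weights y_ge0 gK; rewrite -/h => c2.
have -> : \sum_(w in W) g w * y w = Z.
  under eq_bigr do rewrite mulr_suml.
  rewrite exchange_big; apply: eq_bigr => x _ /=.
  rewrite expr2 mulr_sumr; apply: eq_bigr => w _.
  by rewrite mulrA.
move=> ZK.
(* Since [K ^+ 2] contains a factor [Z], one [Z] cancels afterwards, unless [Z] is 0. *)
have Z2 : Z ^+ 2 <= Z * (calM R e ^+ 2 * H) * (h * \sum_(w in W) y w ^+ 2).
  apply: (@le_trans _ _ ((K * \sum_(w in W) c w * y w) ^+ 2)).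
    by rewrite lerXn2r ?nnegrE // (le_trans Z0 ZK).
  rewrite exprMn sqr_sqrtr; last by rewrite !mulr_ge0 ?calM_ge0 ?sqr_ge0.
  apply: ler_wpM2l; first by rewrite !mulr_ge0 ?calM_ge0.
  by rewrite -c2 cauchy_schwarz_sum.
move: Z0; rewrite le_eqVlt => /predU1P[<-|Z0]; first by rewrite !mulr_ge0 ?calM_ge0 ?sqr_ge0.
by rewrite -(ler_pM2l Z0); move: Z2; congr (_ <= _); ring.
Qed.

Lemma lambda_max_sqr_le (R : realType) (T : finType) (e : rel T)
    (U W : {set T}) (e_sym : symmetric e) (UW_bip : bipartition e U W) :
  U != set0 ->
  lambda_max R e ^+ 2 <= calM R e ^+ 2 * (\sum_(k < maxdeg_in e U) k.+1%:R^-1)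
    * (\sum_(k < #|W|) (Num.sqrt k.+1%:R - Num.sqrt k%:R) ^+ 2).
Proof.
case/set0Pn => u0 _; set l := lambda_max R e; set C := (X in _ <= X).
have T_gt0 : (0 < #|T|)%N by apply/card_gt0P; exists u0.
have [UW_T UW_dis bip] := UW_bip.
have C0 : 0 <= C.
  by rewrite !mulr_ge0 ?calM_ge0 ?sumr_ge0 // => k _; rewrite ?sqr_ge0 ?invr_ge0.
have [l0|l_neq0] := eqVneq l 0; first by rewrite l0 expr0n.
have [f [x0 fx0] fl] := eigenvalue_adjmxP (lambda_max_eigenvalue R e_sym T_gt0).
have fU u : u \in U -> l * f u = \sum_(w in W) (e u w)%:R * f w.
  move=> uU; rewrite -fl [RHS]big_mkcond; apply: eq_bigr => w _.
  rewrite e_sym mulrC; case euw : (e u w); last by rewrite mul0r if_same.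
  by case/orP: (bip _ _ euw) => /andP[]; [move=> _ ->|rewrite (disjointFr UW_dis uU)].
have fW w : w \in W -> l * f w = \sum_(u in U) f u * (e u w)%:R.
  move=> wW; rewrite -fl [RHS]big_mkcond; apply: eq_bigr => u _.
  case euw : (e u w); last by rewrite mulr0 if_same.
  by case/orP: (bip _ _ euw) => /andP[]; [move=> ->|move=> _; rewrite (disjointFl UW_dis wW)].
(* Multiplied by the nonzero [l], both sides become the sum of [f u * f w] over edges between [U]
   and [W]. *)
have normUW : \sum_(u in U) f u ^+ 2 = \sum_(w in W) f w ^+ 2.
  apply: (mulfI l_neq0); rewrite !mulr_sumr.
  under eq_bigr => u uU do rewrite expr2 mulrA (fU u uU) mulr_suml.
  under [RHS]eq_bigr => w wW do rewrite expr2 mulrA (fW w wW) mulr_suml.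
  by rewrite exchange_big; apply: eq_bigr => w _; apply: eq_bigr => u _; ring.
have norm_gt0 : 0 < \sum_(w in W) f w ^+ 2.
  have : 0 < \sum_(u in U) f u ^+ 2 + \sum_(w in W) f w ^+ 2.
    have f2 (A : {set T}) : 0 <= \sum_(x in A) f x ^+ 2.
      by apply: sumr_ge0 => x _; exact: sqr_ge0.
    have f2x (A : {set T}) : x0 \in A -> 0 < \sum_(x in A) f x ^+ 2.
      move=> x0A; rewrite (big_setD1 x0) //= ltr_wpDr ?f2 //.
      by rewrite lt_neqAle sqr_ge0 eq_sym sqrf_eq0 fx0.
    have := in_setT x0; rewrite -UW_T inE => /orP[/f2x|/f2x] h.
      by rewrite ltr_wpDr ?f2.
    by rewrite ltr_wpDl ?f2.
  by rewrite normUW; lra.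
rewrite -(ler_pM2r norm_gt0).
have := sum_neighbours_sqr_le UW_bip (fun w _ => normr_ge0 (f w)).
under [X in _ <= _ * X]eq_bigr do rewrite real_normK ?num_real //.
(* Terms outside [U] are dropped; on [U], the eigenvalue equation and the triangle inequality bound
   [|l * f u|] by the sum of [|f w|] over neighbours. *)
apply: le_trans; rewrite -normUW mulr_sumr big_mkcond; apply: ler_sum => u _.
case: ifP => uU; last exact: sqr_ge0.
rewrite -exprMn fU // -[leLHS]real_normK ?num_real // lerXn2r ?nnegrE //.
  by apply: sumr_ge0 => w _; rewrite mulr_ge0.
apply: le_trans (ler_norm_sum _ _ _) _; apply: ler_sum => w _.
by rewrite normrM normr_nat.
Qed.

Theorem theorem2 (R : realType) (V : finType) (e : rel V) (U W : {set V})
    (e_simple : simple_graph e) (UW_bip : bipartition e U W)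
    (U_neq0 : U != set0) (W_neq0 : W != set0) :
  calM R e <= lambda_max R e /\
  lambda_max R e <=
    Num.sqrt ((ln (maxdeg_in e U)%:R + 1) * (4^-1 * ln #|W|%:R + 1)) * calM R e.
Proof.
have [e_sym _] := e_simple; split; first exact: calM_le_lambda_max UW_bip U_neq0.
have h1 := harmonic_le_ln R (maxdeg_in e U).
have h2 : \sum_(k < #|W|) (Num.sqrt k.+1%:R - Num.sqrt k%:R) ^+ 2
    <= 4^-1 * ln #|W|%:R + 1 :> R.
  by move: W_neq0; rewrite -card_gt0; case: #|W| => // n _; exact: sum_sqrt_incr_sqr_le.
(* Both factors are rewritten as roots of squares, reducing the claim to [lambda_max_sqr_le]. *)
apply: le_trans (ler_norm _) _.
rewrite -sqrtr_sqr -[X in _ <= _ * X](ger0_norm (calM_ge0 R e)) -sqrtr_sqr.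
rewrite mulrC -sqrtrM ?sqr_ge0 // ler_wsqrtr //.
apply: le_trans (lambda_max_sqr_le R e_sym UW_bip U_neq0) _.
rewrite -mulrA ler_wpM2l ?sqr_ge0 //.
apply: ler_pM => //; apply: sumr_ge0 => k _; first by rewrite invr_ge0.
exact: sqr_ge0.
Qed.
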